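(* Let $K$ be an arbitrary field, let $V$ be a vector space of finite dimension $n$ over $K$, and let $\mathcal{M}$ be a non-zero subspace of $\mathrm{Symm}(V)$. Suppose that the rank of each non-zero element of $\mathcal{M}$ is odd, and that $r$ is the maximum rank of the elements of $\mathcal{M}$. Then \[ \dim \mathcal{M}\leq \frac{r(r+1)}{2}. \]
   Context: $\mathrm{Symm}(V)$ denotes the $K$-vector space of symmetric bilinear forms $V\times V\to K$. The rank of a form $f$ is $\dim V-\dim \mathrm{rad}\,f$, where $\mathrm{rad}\,f=\{u\in V: f(u,v)=0 \text{ for all } v\in V\}$ (equivalently, the rank of a Gram matrix of $f$). *)

(* Defs.v *)
From HB Require Import structures.
From mathcomp Require Import all_boot all_order all_algebra.

Set Implicit Arguments.
Unset Strict Implicit.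
Unset Printing Implicit Defensive.

Import GRing.Theory.
Local Open Scope ring_scope.

Section BilinearForms.
Variables (K : fieldType) (V : vectType K).

(* Bilinear forms V * V -> K, in curried form: [f u v] is the value of f at    *)
(* (u, v). Unlike the function type {biscalar V}, this is a vectType over K,   *)
(* with pointwise operations, so that it has subspaces and dimensions.         *)
Definition bilform := 'Hom(V, 'Hom(V, K^o)).

Lemma bilform_eqP (f g : bilform) : (forall u v, f u v = g u v) <-> f = g.
Proof. by split=> [fg | -> //]; apply/lfunP => u; apply/lfunP => v. Qed.

Definition bilform_evalr (f : bilform) (v : V) : V -> K^o := fun u => f u v.

Fact bilform_evalr_is_linear f v : linear (bilform_evalr f v).
Proof.
by move=> a u w; rewrite /bilform_evalr linearP add_lfunE scale_lfunE.
Qed.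
HB.instance Definition _ f v :=
  GRing.isLinear.Build K V K^o _ (bilform_evalr f v)
    (bilform_evalr_is_linear f v).

Definition bilform_swap_fun (f : bilform) (v : V) : 'Hom(V, K^o) :=
  linfun (bilform_evalr f v).

Fact bilform_swap_fun_is_linear f : linear (bilform_swap_fun f).
Proof.
move=> a v w; apply/lfunP => u.
by rewrite add_lfunE scale_lfunE !lfunE /= /bilform_evalr linearP.
Qed.
HB.instance Definition _ f :=
  GRing.isLinear.Build K V 'Hom(V, K^o) _ (bilform_swap_fun f)
    (bilform_swap_fun_is_linear f).

Definition bilform_swap (f : bilform) : bilform := linfun (bilform_swap_fun f).

Lemma bilform_swapE f u v : bilform_swap f u v = f v u.
Proof. by rewrite /bilform_swap lfunE /= /bilform_swap_fun lfunE. Qed.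

Definition bilform_antisym (f : bilform) : bilform := f - bilform_swap f.

Fact bilform_antisym_is_linear : linear bilform_antisym.
Proof.
move=> a f g; rewrite /bilform_antisym scalerBr addrACA -opprD; congr (_ - _).
apply/bilform_eqP => u v; rewrite bilform_swapE.
by rewrite !(add_lfunE, scale_lfunE) !bilform_swapE.
Qed.
HB.instance Definition _ :=
  GRing.isLinear.Build K bilform bilform _ bilform_antisym
    bilform_antisym_is_linear.

(* The vector space of symmetric bilinear forms, see [memv_Symm].              *)
Definition Symm : {vspace bilform} := lker (linfun bilform_antisym).

Lemma memv_Symm (f : bilform) :
  f \in Symm <-> forall u v : V, f u v = f v u.
Proof.
rewrite memv_ker lfunE /= subr_eq0; split=> [/eqP fS u v | fS].
  by rewrite {1}fS bilform_swapE.
by apply/eqP/bilform_eqP => u v; rewrite bilform_swapE fS.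
Qed.

(* Every bilinear map V -> V -> K in the sense of sesquilinear.v is obtained.  *)
Lemma bilform_of_biscalar (b : {biscalar V}) :
  exists f : bilform, forall u v : V, f u v = b u v.
Proof.
have lr u : linear (b u : V -> K^o) by move=> a v w; rewrite linearPr.
pose Lr u := GRing.isLinear.Build K V K^o _ (b u : V -> K^o) (lr u).
pose br u : {linear V -> K^o} := HB.pack (b u : V -> K^o) (Lr u).
pose c u : 'Hom(V, K^o) := linfun (br u).
have lc : linear c.
  move=> a u w; apply/lfunP => v.
  by rewrite add_lfunE scale_lfunE !lfunE /= linearPl.
pose Lc := GRing.isLinear.Build K V 'Hom(V, K^o) _ c lc.
pose bc : {linear V -> 'Hom(V, K^o)} := HB.pack c Lc.
by exists (linfun bc) => u v; rewrite !lfunE.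
Qed.

(* The radical is the kernel of u |-> f(u, -), see [memv_rad].                 *)
Definition rad (f : bilform) : {vspace V} := lker f.

Lemma memv_rad (f : bilform) (u : V) :
  u \in rad f <-> forall v : V, f u v = 0.
Proof.
rewrite memv_ker; split=> [/eqP-> v | fu0]; first by rewrite zero_lfunE.
by apply/eqP/lfunP => v; rewrite zero_lfunE fu0.
Qed.

Definition bilform_rank (f : bilform) : nat := (\dim {:V} - \dim (rad f))%N.

End BilinearForms.

Arguments Symm {K} V.

(* Main.v *)
From HB Require Import structures.
Require Import Defs.
From mathcomp Require Import all_boot all_order all_algebra.
Local Open Scope ring_scope.

Import GRing.Theory.

(** Fix f in M of maximal rank r and a complement U of its radical, so that
    dim U = r. The forms on U that are restrictions of symmetric forms make up a
    space of dimension at most r (r + 1) / 2, hence it is enough to see that no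
    non-zero g in M vanishes on U x U ([dim_le_restriction]).

    Suppose that g does, and let h = f + g. Then h agrees with f on U x U, where
    f is non-degenerate, so rad h meets U trivially; as h also lies in M, its
    rank is at most r, and therefore U is a complement of rad h as well
    ([complement_rad]). Two symmetric forms that agree on a common complement U
    of their radicals differ by a form of even rank ([even_rank_sub]): for
    g = h - f, the subspace W = U + (rad f :&: rad h) is its own orthogonal, and
    the existence of such a W forces the rank to be 2 (dim V - dim W)
    ([even_rank_lagrangian]). In M the only form of even rank is 0.

    No scalar multiples of f are used, which is why the argument also covers
    fields with two elements, and nothing is divided by 2. *)

Section SymmetricForms.
Set Implicit Arguments.
Unset Strict Implicit.
Variables (K : fieldType) (V : vectType K).
(* The name [rad] is also that of the radical of a sesquilinear matrix. *)
Local Notation rad := Defs.rad.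
Implicit Types (f g h : bilform V) (U W : {vspace V}).

Lemma bilformDr f u v w : f u (v + w) = f u v + f u w.
Proof. exact: linearD. Qed.

Lemma bilformDl f u v w : f (u + v) w = f u w + f v w.
Proof. by rewrite linearD add_lfunE. Qed.

(** The form embeds U into the dual of W. *)
Lemma dim_separated f U W :
    (forall u, u \in U -> (forall w, w \in W -> f u w = 0) -> u = 0) ->
  (\dim U <= \dim W)%N.
Proof.
move=> sep; pose phi u : {ffun 'I_(\dim W) -> K^o} :=
    [ffun i : 'I_(\dim W) => f u (vbasis W)`_i].
have phi_lin : linear phi.
  by move=> a u v; apply/ffunP=> i; rewrite !ffunE linearP add_lfunE scale_lfunE.
pose phiL := GRing.isLinear.Build K V _ _ phi phi_lin.
pose phi' : {linear V -> _} := HB.pack phi phiL.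
have inj_phi : (U :&: lker (linfun phi') = 0)%VS.
  apply/eqP; rewrite -subv0; apply/subvP=> u.
  rewrite memv_cap memv_ker lfunE /= memv0 => /andP[uU /eqP phiu0].
  apply/eqP/sep=> // w wW; rewrite (coord_vbasis wW) linear_sum big1 // => i _.
  have /ffunP/(_ i) := phiu0; rewrite !ffunE => fui0.
  by rewrite linearZ /= fui0 scaler0.
rewrite -(limg_dim_eq inj_phi) (leq_trans (dimvS (subvf _))) //.
by rewrite dimvf /dim /= card_ord muln1.
Qed.

(** If W is its own orthogonal, f induces a perfect pairing between V / W and
    W / rad f, so these have the same dimension; the rank, which is the sum of
    the two dimensions, is thus even. Complements stand for the quotients. *)
Lemma even_rank_lagrangian f W :
    (forall u v, f u v = f v u) ->
    (forall v, v \in W <-> forall w, w \in W -> f v w = 0) ->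
  ~~ odd (bilform_rank f).
Proof.
move=> fS Wlag.
have radW : (rad f <= W)%VS.
  by apply/subvP=> v /memv_rad fv0; apply/Wlag=> w _; apply: fv0.
have le1 : (\dim W^C <= \dim (W :\: rad f))%N.
  apply: (dim_separated (f := f)) => u uWC fu0; apply/eqP.
  rewrite -memv0 -(capv_compl W) memv_cap uWC andbT; apply/Wlag=> w.
  rewrite -(addv_diff_cap W (rad f)) => /memv_addP[x xW [y yW ->]].
  move: yW; rewrite memv_cap => /andP[_ /memv_rad fy0].
  by rewrite bilformDr fu0 // fS fy0 addr0.
have le2 : (\dim (W :\: rad f) <= \dim W^C)%N.
  apply: (dim_separated (f := f)) => u uWr fu0; apply/eqP.
  have /subvP/(_ u uWr) uW := diffvSl W (rad f).
  rewrite -memv0 -(capv_diff W (rad f)) memv_cap uWr.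
  apply/memv_rad=> v.
  have : v \in (W + W^C)%VS by rewrite addv_complf memvf.
  move=> /memv_addP[x xW [y yW ->]].
  by rewrite bilformDr (fu0 y) // addr0; move/Wlag: uW; apply.
have eqW : \dim (W :\: rad f) = \dim W^C by apply/eqP; rewrite eqn_leq le1 le2.
have := dimv_cap_compl W (rad f); rewrite (capv_idPr radW) eqW => dimW.
have dimV : \dim {:V} = (\dim W + \dim W^C)%N.
  by rewrite dimv_compl subnKC // dimvS // subvf.
by rewrite /bilform_rank dimV -dimW -addnA addKn addnn odd_double.
Qed.

(** The orthogonal of U under g = h - f is W = U + (rad f :&: rad h). Indeed, if
    v = u + x with u in U and x in rad f is orthogonal to U, then so is x; as
    f x = 0, this says that h x vanishes on U, hence on U + rad h = V. Since g
    vanishes on U x U and rad f :&: rad h lies in its radical, W is isotropic. *)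
Lemma even_rank_sub f h U :
    (forall u v, f u v = f v u) -> (forall u v, h u v = h v u) ->
    (U + rad f = fullv)%VS -> (U + rad h = fullv)%VS ->
    (forall u v, u \in U -> v \in U -> h u v = f u v) ->
  ~~ odd (bilform_rank (h - f)).
Proof.
move=> fS hS Uf Uh hf.
have gE u v : (h - f) u v = h u v - f u v by rewrite !(add_lfunE, opp_lfunE).
have gS u v : (h - f) u v = (h - f) v u by rewrite !gE hS fS.
apply: (even_rank_lagrangian (W := (U + rad f :&: rad h)%VS)) => // v; split.
  move=> /memv_addP[u uU [x]]; rewrite memv_cap.
  move=> /andP[/memv_rad fx /memv_rad hx] -> w.
  move=> /memv_addP[u' u'U [x']]; rewrite memv_cap.
  move=> /andP[/memv_rad fx' /memv_rad hx'] ->.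
  rewrite bilformDl [X in _ + X]gE hx fx subr0 addr0.
  by rewrite gS bilformDl !gE hx' fx' hf // !subrr addr0.
move=> gvW.
have : v \in (U + rad f)%VS by rewrite Uf memvf.
move=> /memv_addP[u uU [x xR vE]]; rewrite vE memv_add // memv_cap xR /=.
apply/memv_rad=> w.
have : w \in (U + rad h)%VS by rewrite Uh memvf.
move=> /memv_addP[u' u'U [y /memv_rad hy ->]].
rewrite bilformDr (hS x y) hy addr0.
have := gvW u' (subvP (addvSl _ _) _ u'U).
move/memv_rad: xR => fx.
by rewrite gE vE !bilformDl fx hf // opprD addrACA subrr add0r subr0.
Qed.

(** Two complements of radicals: f is non-degenerate on U, and h = f there, so U
    meets rad h trivially; the bound on the rank of h makes rad h large enough
    to fill up V. *)
Lemma complement_rad f h U :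
    (forall u v, f u v = f v u) ->
    (U :&: rad f = 0)%VS -> (U + rad f = fullv)%VS ->
    (forall u v, u \in U -> v \in U -> h u v = f u v) ->
    (bilform_rank h <= \dim U)%N ->
  (U + rad h = fullv)%VS.
Proof.
move=> fS Uf0 Uf hf rank_h.
have Uh0 : (U :&: rad h = 0)%VS.
  apply/eqP; rewrite -subv0; apply/subvP=> u.
  rewrite memv_cap => /andP[uU /memv_rad hu0].
  rewrite -Uf0 memv_cap uU; apply/memv_rad=> v.
  have : v \in (U + rad f)%VS by rewrite Uf memvf.
  move=> /memv_addP[u' u'U [x /memv_rad fx ->]].
  by rewrite bilformDr (fS u x) fx addr0 -hf.
apply/eqP; rewrite eqEdim subvf (dimv_disjoint_sum Uh0).
by rewrite addnC -leq_subLR.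
Qed.

Lemma card_upper_triangle d :
  #|{: {p : 'I_d * 'I_d | (p.1 <= p.2)%N}}| = ((d * (d + 1)) %/ 2)%N.
Proof.
rewrite card_sig -sum1_card.
rewrite -(pair_big_dep xpredT (fun i j : 'I_d => (i <= j)%N)
  (fun _ _ => 1%N)) /= (exchange_big_dep xpredT) //=.
transitivity (\sum_(j < d) j.+1)%N.
  apply: eq_bigr => j _.
  by rewrite (big_ord_narrow (ltn_ord j)) sum1_card card_ord.
by rewrite addn1 mulnC divn2 -bin2 -bin2_sum big_mkord big_ord_recl.
Qed.

(** A symmetric form on U is determined by the upper triangle of its Gram
    matrix, and by hypothesis restriction to U is injective on M. *)
Lemma dim_le_restriction (M : {vspace bilform V}) U :
    (M <= Symm V)%VS ->
    (forall g, g \in M -> (forall u v, u \in U -> v \in U -> g u v = 0) ->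
       g = 0) ->
  (\dim M <= (\dim U * (\dim U + 1)) %/ 2)%N.
Proof.
move=> /subvP MS sep; set d := \dim U.
pose b (i : 'I_d) := (vbasis U)`_i.
pose I := {p : 'I_d * 'I_d | (p.1 <= p.2)%N}.
pose phi g : {ffun I -> K^o} := [ffun p : I => g (b (val p).1) (b (val p).2)].
have phi_lin : linear phi.
  by move=> a g h; apply/ffunP=> p; rewrite !ffunE !(add_lfunE, scale_lfunE).
pose phiL := GRing.isLinear.Build K (bilform V) _ _ phi phi_lin.
pose phi' : {linear bilform V -> _} := HB.pack phi phiL.
have inj_phi : (M :&: lker (linfun phi') = 0)%VS.
  apply/eqP; rewrite -subv0; apply/subvP=> g.
  rewrite memv_cap memv_ker lfunE /= memv0 => /andP[gM /eqP phig0].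
  have gS := (memv_Symm g).1 (MS g gM).
  have gb (i j : 'I_d) : g (b i) (b j) = 0.
    wlog ij : i j / (i <= j)%N.
      by move=> th; case/orP: (leq_total i j) => /th; rewrite // gS.
    by have /ffunP/(_ (exist _ (i, j) ij)) := phig0; rewrite !ffunE.
  apply/eqP/sep=> // u v uU vU.
  rewrite (coord_vbasis uU) (coord_vbasis vU) linear_sum big1 // => j _.
  rewrite linearZ linear_sum /= sum_lfunE big1 ?scaler0 // => i _.
  by rewrite linearZ /= scale_lfunE [X in _ *: X]gb scaler0.
rewrite -(limg_dim_eq inj_phi) (leq_trans (dimvS (subvf _))) //.
by rewrite dimvf /dim /= muln1 card_upper_triangle.
Qed.

End SymmetricForms.

Theorem corollary1 (K : fieldType) (V : vectType K) (n : nat)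
    (dimV : \dim {:V} = n)
    (M : {vspace bilform V}) (M_symm : (M <= Symm V)%VS)
    (M_neq0 : M != 0%VS)
    (M_odd : forall f : bilform V, f \in M -> f != 0 -> odd (bilform_rank f))
    (r : nat)
    (r_attained : exists2 f : bilform V, f \in M & bilform_rank f = r)
    (r_max : forall f : bilform V, f \in M -> (bilform_rank f <= r)%N) :
  (\dim M <= (r * (r + 1)) %/ 2)%N.
Proof.
have [f fM rf] := r_attained; pose U := (Defs.rad f)^C%VS.
have dimU : \dim U = r by rewrite dimv_compl.
have MS g : g \in M -> forall u v, g u v = g v u.
  by move=> gM; apply/memv_Symm/(subvP M_symm).
rewrite -dimU; apply: dim_le_restriction => // g gM gU.
apply/eqP; apply: contraTT isT => g0.
have hM : f + g \in M by rewrite memvD.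
have Uf : (U + Defs.rad f = fullv)%VS by rewrite addvC addv_complf.
have hf u v : u \in U -> v \in U -> (f + g) u v = f u v.
  by move=> uU vU; rewrite !add_lfunE gU // addr0.
have Uh : (U + Defs.rad (f + g)%R = fullv)%VS.
  by apply: (complement_rad (MS f fM)); rewrite // ?dimU ?r_max // capvC capv_compl.
have := even_rank_sub (MS f fM) (MS _ hM) Uf Uh hf.
by rewrite [f + g]addrC addrK M_odd.
Qed.
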